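(* On a uniform 1D mesh of size $\Delta x$, let $\bar u_i^n$ be cell averages and $u_{i+\frac12}^n$ interface point values, and put $\mu=\Delta t^n/\Delta x$, $\nu=\Delta t^n/\Delta x^2$. Suppose that the low-order intermediate states $u_i^{\mathrm L,\pm}$ (defined in the context) satisfy $u_i^{\mathrm L,\pm}\in[u_{\min},u_{\max}]$ for all $i$, and that the CFL condition $$\Delta t^n\le\frac{C_{\mathrm{CFL}}}{\displaystyle\max_i\Bigl(\frac{\alpha_{i+\frac12}^n}{\Delta x}+\frac{\kappa_{\max}}{\Delta x^2}\Bigr)},\qquad C_{\mathrm{CFL}}\le\tfrac12,$$ holds. Consider the limited scheme $$\bar u_i^{\mathrm{Lim}}=\bar u_i^n-\mu\bigl(\hat f^{\mathrm{Lim}}_{i+\frac12}-\hat f^{\mathrm{Lim}}_{i-\frac12}\bigr)+\nu\bigl(\hat a^{\mathrm{Lim}}_{i+1}-2\hat a^{\mathrm{Lim}}_i+\hat a^{\mathrm{Lim}}_{i-1}\bigr),$$ $$\hat f^{\mathrm{Lim}}_{i+\frac12}=\hat f^{\mathrm L}_{i+\frac12}+\theta^{\mathrm c}_{i+\frac12}\Delta\hat f_{i+\frac12},\qquad \hat a^{\mathrm{Lim}}_i=\hat a^{\mathrm L}_i+\theta^{\mathrm d}_i\Delta\hat a_i,$$ with limiting parameters $$\theta^{\mathrm c}_{i+\frac12}=\min\bigl\{\Theta(u_i^{\mathrm L,+},u_i^{\mathrm L,+}-6\mu\Delta\hat f_{i+\frac12}),\ \Theta(u_{i+1}^{\mathrm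 L,-},u_{i+1}^{\mathrm L,-}+6\mu\Delta\hat f_{i+\frac12})\bigr\},$$ $$\theta^{\mathrm d}_i=\min\bigl\{\Theta(u_{i-1}^{\mathrm L,+},u_{i-1}^{\mathrm L,+}+6\nu\Delta\hat a_i),\ \Theta(u_i^{\mathrm L,+},u_i^{\mathrm L,+}-6\nu\Delta\hat a_i),\ \Theta(u_i^{\mathrm L,-},u_i^{\mathrm L,-}-6\nu\Delta\hat a_i),\ \Theta(u_{i+1}^{\mathrm L,-},u_{i+1}^{\mathrm L,-}+6\nu\Delta\hat a_i)\bigr\}.$$ Then the scheme is maximum-principle-preserving for the cell averages, i.e. $\bar u_i^{\mathrm{Lim}}\in[u_{\min},u_{\max}]$ for all $i$. Moreover, the convection discretization remains locally conservative, and the diffusion discretization remains doubly conservative.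
   Context: The equation is $u_t+f(u)_x=a(u)_{xx}$ with $a(u)=\int^u\kappa(s)\,\mathrm ds$, $\kappa\ge0$. Low-order quantities: $\hat f^{\mathrm L}_{i+\frac12}=\frac12(f(\bar u_i^n)+f(\bar u_{i+1}^n))-\frac{\alpha^n_{i+\frac12}}2(\bar u_{i+1}^n-\bar u_i^n)$, where $\alpha^n_{i+\frac12}$ is the maximum of $|f'(u)|$ over $u$ between $\bar u_i^n$ and $\bar u_{i+1}^n$; $\hat a^{\mathrm L}_{i+\frac12}=\frac1{\Delta x}(a(\bar u_{i+1}^n)-a(\bar u_i^n))$; $\hat a^{\mathrm L}_i=a(\bar u_i^n)$; $\kappa_{\max}=\max_{u\in[u_{\min},u_{\max}]}\kappa(u)$. Low-order intermediate states: $$u_i^{\mathrm L,+}=\bar u_i^n-2\mu(\hat f^{\mathrm L}_{i+\frac12}-f(\bar u_i^n))+2\mu\,\hat a^{\mathrm L}_{i+\frac12},\qquad u_i^{\mathrm L,-}=\bar u_i^n-2\mu(f(\bar u_i^n)-\hat f^{\mathrm L}_{i-\frac12})-2\mu\,\hat a^{\mathrm L}_{i-\frac12}.$$ High-order quantities: $\hat f^{\mathrm H}_{i+\frac12}=f(u^n_{i+\frac12})$ and $\hat a^{\mathrm H}_i=\frac16\bigl(-a(u^n_{i-\frac12})+8a(u^n_i)-a(u^n_{i+\frac12})\bigr)$ with $u_i^n=\frac14(6\bar u_i^n-u^n_{i-\frac12}-u^n_{i+\frac12})$. Corrections: $\Delta\hat f_{i+\frac12}=\hat f^{\mathrm H}_{i+\frac12}-\hat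 f^{\mathrm L}_{i+\frac12}$, $\Delta\hat a_i=\hat a^{\mathrm H}_i-\hat a^{\mathrm L}_i$. For $z^{\mathrm L}\in[u_{\min},u_{\max}]$ and real $z^{\mathrm H}$, $$\Theta(z^{\mathrm L},z^{\mathrm H})=\begin{cases}\dfrac{z^{\mathrm L}-u_{\min}}{z^{\mathrm L}-z^{\mathrm H}},&z^{\mathrm H}<u_{\min},\\[1ex]\dfrac{z^{\mathrm L}-u_{\max}}{z^{\mathrm L}-z^{\mathrm H}},&z^{\mathrm H}>u_{\max},\\[1ex]1,&z^{\mathrm H}\in[u_{\min},u_{\max}].\end{cases}$$ Locally conservative: the convection contribution to the update is $-\mu$ times a difference of single-valued interface fluxes consistent with $f$. Doubly conservative: the diffusion contribution is $\nu$ times a second difference $\widetilde a_{i+1}-2\widetilde a_i+\widetilde a_{i-1}$ of single-valued numerical potentials. Consistency means that when all cell averages and point values equal a constant $u$, the numerical flux equals $f(u)$ and the numerical potential equals $a(u)$. Cell indices are understood periodically. *)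

(* Defs.v *)
From mathcomp Require Import all_boot all_order all_algebra.
From mathcomp Require Import all_classical all_reals all_analysis.

Set Implicit Arguments.
Unset Strict Implicit.
Unset Printing Implicit Defensive.

Import Order.TTheory GRing.Theory Num.Theory.
Import numFieldNormedType.Exports.

Local Open Scope classical_set_scope.
Local Open Scope ring_scope.

(* [sup A] is the maximum of A whenever [has_maximum A]. *)
Definition has_maximum (R : realType) (A : set R) : Prop :=
  exists2 m, A m & ubound A m.

(* a(u) = \int^u kappa(s) ds: the lower limit, i.e. the additive constant of a,
   is left free. *)
Definition indefinite_integral (R : realType) (kappa a : R -> R) : Prop :=
  locally_integrable setT kappa /\
  forall v w : R, v <= w ->
    a w - a v = \int[lebesgue_measure]_(x in `[v, w]) kappa x.

(* Periodic mesh with N cells: the neighbours i+1 and i-1 of cell i are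
   [ordS i] and [ord_pred i].  Interface quantities are indexed by the cell on
   their left, so index i stands for i+1/2 and [ord_pred i] for i-1/2. *)
Record state (R : realType) (N : nat) := State {
  avg : 'I_N -> R;  (* cell averages *)
  pt : 'I_N -> R    (* interface point values *)
}.

Definition const_state (R : realType) (N : nat) (u : R) : state R N :=
  {| avg := fun=> u; pt := fun=> u |}.

Section Scheme.
Context (R : realType) (N : nat).
Context (f kappa a : R -> R) (umin umax dx dt : R).
Implicit Types (s : state R N) (i : 'I_N).

Let mu := dt / dx.
Let nu := dt / dx ^+ 2.

(* The maximum of |f'| between v and w. *)
Definition max_speed (v w : R) : R :=
  sup [set `|derive1 f u| | u in `[Num.min v w, Num.max v w]].

Definition alpha s i : R := max_speed (avg s i) (avg s (ordS i)).

Definition kappa_max : R := sup (kappa @` `[umin, umax]).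

(* The base point 0 of the maximum is harmless: all terms are nonnegative when
   kappa is.  The condition dt <= CFL / max is stated as dt * max <= CFL, which
   also covers max = 0 (no restriction), where Rocq's CFL / 0 would be 0. *)
Definition CFL_condition (CFL : R) s : Prop :=
  dt * \big[Num.max/0]_(i < N) (alpha s i / dx + kappa_max / dx ^+ 2) <= CFL.

Definition fL s i : R :=
  (f (avg s i) + f (avg s (ordS i))) / 2
  - alpha s i / 2 * (avg s (ordS i) - avg s i).

Definition aL_half s i : R := (a (avg s (ordS i)) - a (avg s i)) / dx.

Definition aL s i : R := a (avg s i).

Definition uL_plus s i : R :=
  avg s i - 2 * mu * (fL s i - f (avg s i)) + 2 * mu * aL_half s i.

Definition uL_minus s i : R :=
  avg s i - 2 * mu * (f (avg s i) - fL s (ord_pred i))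
  - 2 * mu * aL_half s (ord_pred i).

Definition fH s i : R := f (pt s i).

Definition u_mid s i : R := (6 * avg s i - pt s (ord_pred i) - pt s i) / 4.

Definition aH s i : R :=
  (- a (pt s (ord_pred i)) + 8 * a (u_mid s i) - a (pt s i)) / 6.

Definition Delta_f s i : R := fH s i - fL s i.

Definition Delta_a s i : R := aH s i - aL s i.

Definition Theta (zL zH : R) : R :=
  if zH < umin then (zL - umin) / (zL - zH)
  else if umax < zH then (zL - umax) / (zL - zH)
  else 1.

Definition theta_c s i : R :=
  Num.min
    (Theta (uL_plus s i) (uL_plus s i - 6 * mu * Delta_f s i))
    (Theta (uL_minus s (ordS i)) (uL_minus s (ordS i) + 6 * mu * Delta_f s i)).

Definition theta_d s i : R :=
  Num.min
    (Num.min
      (Theta (uL_plus s (ord_pred i))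
             (uL_plus s (ord_pred i) + 6 * nu * Delta_a s i))
      (Theta (uL_plus s i) (uL_plus s i - 6 * nu * Delta_a s i)))
    (Num.min
      (Theta (uL_minus s i) (uL_minus s i - 6 * nu * Delta_a s i))
      (Theta (uL_minus s (ordS i))
             (uL_minus s (ordS i) + 6 * nu * Delta_a s i))).

Definition fLim s i : R := fL s i + theta_c s i * Delta_f s i.

Definition aLim s i : R := aL s i + theta_d s i * Delta_a s i.

Definition convection_Lim s i : R := - mu * (fLim s i - fLim s (ord_pred i)).

Definition diffusion_Lim s i : R :=
  nu * (aLim s (ordS i) - 2 * aLim s i + aLim s (ord_pred i)).

Definition avg_Lim s i : R := avg s i + convection_Lim s i + diffusion_Lim s i.

(* The contribution [conv] to the update is -mu times a difference of the
   interface fluxes F (one value per interface, shared by the two adjacent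
   cells), and F is consistent with f. *)
Definition locally_conservative (conv F : state R N -> 'I_N -> R) : Prop :=
  (forall s i, conv s i = - mu * (F s i - F s (ord_pred i))) /\
  (forall (u : R) i, F (const_state N u) i = f u).

(* The contribution [diff] to the update is nu times a second difference of the
   potentials A (one value per cell), and A is consistent with a. *)
Definition doubly_conservative (diff A : state R N -> 'I_N -> R) : Prop :=
  (forall s i, diff s i = nu * (A s (ordS i) - 2 * A s i + A s (ord_pred i))) /\
  (forall (u : R) i, A (const_state N u) i = a u).

End Scheme.

(* Main.v *)
(** The limited average is the mean of six states, three of the form
    [uL_plus s i + theta * d] and three of the form [uL_minus s i + theta * d],
    because [(uL_plus s i + uL_minus s i) / 2] is the low-order update.  Each
    [theta] is nonnegative and at most the value [Theta] gives to its own state,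
    so all six states, and hence their mean, lie in [[umin, umax]]. *)

Require Import Defs.
From mathcomp Require Import all_boot all_order all_algebra.
From mathcomp Require Import all_classical all_reals all_analysis.
From mathcomp Require Import ring lra.

Import Order.TTheory GRing.Theory Num.Theory.
Import numFieldNormedType.Exports.

Local Open Scope classical_set_scope.
Local Open Scope ring_scope.

Section Limiter.
Context (R : realType) (umin umax : R).
Implicit Types zL zH d t : R.

Lemma Theta_ge0 zL zH : umin <= zL <= umax -> 0 <= Theta umin umax zL zH.
Proof.
move=> /andP[lo hi]; rewrite /Theta; case: ifP => [lt_min|_].
  by apply: divr_ge0; lra.
by case: ifP => // gt_max; apply: mulr_le0; rewrite ?invr_le0; lra.
Qed.

(** If [zL + d] leaves the interval, [Theta] is the exact fraction of [d] that lands on the bound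
    crossed, so a smaller nonnegative fraction stops between [zL] and that bound. Otherwise [Theta]
    is 1 and convexity of the interval suffices. *)
Lemma Theta_limited zL d t : umin <= zL <= umax ->
  0 <= t <= Theta umin umax zL (zL + d) -> umin <= zL + t * d <= umax.
Proof.
move=> /andP[lo hi] /andP[t_ge0]; rewrite /Theta.
have -> : zL - (zL + d) = - d by ring.
case: ifP => [lt_min|/negbT].
  by rewrite ler_pdivlMr; [move=> t_le; apply/andP; split; nra|lra].
rewrite -leNgt => ge_min; case: ifP => [gt_max|/negbT].
  (* Here [d > 0]: the quotient is rewritten as [(umax - zL) / d] so that the denominator to be
     cleared is positive. *)
  rewrite invrN mulrN -mulNr opprB ler_pdivlMr; last lra.
  by move=> t_le; apply/andP; split; nra.
by rewrite -leNgt => le_max t_le1; apply/andP; split; nra.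
Qed.

End Limiter.

Section LimitedScheme.
Context (R : realType) (N : nat) (f a : R -> R) (umin umax dx dt : R).
Implicit Types (s : state R N) (i : 'I_N).

Let mu := dt / dx.
Let nu := dt / dx ^+ 2.

Section MaximumPrinciple.
Context (s : state R N).
Hypothesis uL_plus_bounds :
  forall i, umin <= uL_plus f a dx dt s i <= umax.
Hypothesis uL_minus_bounds :
  forall i, umin <= uL_minus f a dx dt s i <= umax.

Let uLp := uL_plus f a dx dt s.
Let uLm := uL_minus f a dx dt s.
Let thc := theta_c f a umin umax dx dt s.
Let thd := theta_d f a umin umax dx dt s.
Let df := Delta_f f s.
Let da := Delta_a a s.

Lemma theta_c_ge0 i : 0 <= thc i.
Proof. by rewrite /thc /theta_c le_min !Theta_ge0. Qed.

Lemma theta_d_ge0 i : 0 <= thd i.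
Proof. by rewrite /thd /theta_d !le_min !Theta_ge0. Qed.

(** An interface correction enters its two adjacent cells with opposite signs. The minimum in
    [theta_c] lets a single value serve both, here the left cell and in the next lemma the right
    one. *)
Lemma convection_limited_plus i :
  umin <= uLp i + thc i * (- (6 * mu * df i)) <= umax.
Proof.
apply: Theta_limited; first exact: uL_plus_bounds.
by rewrite theta_c_ge0 /thc /theta_c ge_min lexx.
Qed.

Lemma convection_limited_minus i :
  umin <= uLm (ordS i) + thc i * (6 * mu * df i) <= umax.
Proof.
apply: Theta_limited; first exact: uL_minus_bounds.
by rewrite theta_c_ge0 /thc /theta_c ge_min lexx orbT.
Qed.

(** A potential correction reaches three cells through the second difference. It is tested on four
    states because its weight [-2] in cell [i] is shared equally by [uLp i] and [uLm i]. *)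
Lemma diffusion_limited_plus_pred i :
  umin <= uLp (ord_pred i) + thd i * (6 * nu * da i) <= umax.
Proof.
apply: Theta_limited; first exact: uL_plus_bounds.
by rewrite theta_d_ge0 /thd /theta_d !ge_min lexx.
Qed.

Lemma diffusion_limited_plus i :
  umin <= uLp i + thd i * (- (6 * nu * da i)) <= umax.
Proof.
apply: Theta_limited; first exact: uL_plus_bounds.
by rewrite theta_d_ge0 /thd /theta_d !ge_min lexx ?orbT.
Qed.

Lemma diffusion_limited_minus i :
  umin <= uLm i + thd i * (- (6 * nu * da i)) <= umax.
Proof.
apply: Theta_limited; first exact: uL_minus_bounds.
by rewrite theta_d_ge0 /thd /theta_d !ge_min lexx ?orbT.
Qed.

Lemma diffusion_limited_minus_succ i :
  umin <= uLm (ordS i) + thd i * (6 * nu * da i) <= umax.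
Proof.
apply: Theta_limited; first exact: uL_minus_bounds.
by rewrite theta_d_ge0 /thd /theta_d !ge_min lexx ?orbT.
Qed.

(** The two flux corrections and the four potential corrections, the weight [-2] counting as two,
    are dealt out one to each state; this explains the factor 6 in the limiters. *)
Lemma avg_Lim_mean i : dx != 0 ->
  6 * avg_Lim f a umin umax dx dt s i =
    (uLp i + thc i * (- (6 * mu * df i))) +
    (uLm i + thc (ord_pred i) * (6 * mu * df (ord_pred i))) +
    (uLp i + thd (ordS i) * (6 * nu * da (ordS i))) +
    (uLp i + thd i * (- (6 * nu * da i))) +
    (uLm i + thd i * (- (6 * nu * da i))) +
    (uLm i + thd (ord_pred i) * (6 * nu * da (ord_pred i))).
Proof.
move=> dx_neq0.
rewrite /avg_Lim /convection_Lim /diffusion_Lim /fLim /aLim.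
(* [ord_predK] identifies the right end of the left interface with cell [i], so that the two
   [aL_half] terms combine into a second difference. *)
rewrite /uLp /uLm /uL_plus /uL_minus /aL_half /aL ord_predK.
by rewrite /thc /thd /df /da /mu /nu; field.
Qed.

Lemma avg_Lim_bounds i : dx != 0 ->
  umin <= avg_Lim f a umin umax dx dt s i <= umax.
Proof.
move=> /(avg_Lim_mean i) mean.
(* Each bound is instantiated at the index that brings its state to cell [i]. *)
have := convection_limited_plus i.
have := convection_limited_minus (ord_pred i).
have := diffusion_limited_plus_pred (ordS i).
have := diffusion_limited_plus i.
have := diffusion_limited_minus i.
have := diffusion_limited_minus_succ (ord_pred i).
rewrite ord_predK ordSK.
move=> /andP[? ?] /andP[? ?] /andP[? ?] /andP[? ?] /andP[? ?] /andP[? ?].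
by apply/andP; split; lra.
Qed.

End MaximumPrinciple.

(** On a constant state the jump multiplying [alpha] vanishes, so both fluxes are [f u] and the
    limited correction is zero. *)
Lemma fLim_const u i :
  fLim f a umin umax dx dt (const_state N u) i = f u.
Proof.
have fL_const : fL f (const_state N u) i = f u by rewrite /fL /=; field.
by rewrite /fLim /Delta_f fL_const /fH /= subrr mulr0 addr0.
Qed.

(** The weights of [u_mid] and of [aH] each sum to 1, so the correction vanishes here too. *)
Lemma aLim_const u i :
  aLim f a umin umax dx dt (const_state N u) i = a u.
Proof.
have mid : u_mid (const_state N u) i = u by rewrite /u_mid /=; field.
have aH_const : aH a (const_state N u) i = a u by rewrite /aH mid /=; field.
by rewrite /aLim /Delta_a aH_const /aL /= subrr mulr0 addr0.
Qed.

End LimitedScheme.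

Theorem proposition5p1 (R : realType) (N : nat) (f kappa a : R -> R)
    (umin umax dx dt CFL : R) (s : state R N)
    (N_gt0 : (0 < N)%N) (dx_gt0 : 0 < dx) (dt_gt0 : 0 < dt)
    (f_derivable : forall u : R, derivable f u 1)
    (max_speed_exists : forall v w : R, v <= w ->
       has_maximum [set `|derive1 f u| | u in `[v, w]])
    (kappa_ge0 : forall u : R, 0 <= kappa u)
    (kappa_max_exists : has_maximum (kappa @` `[umin, umax]))
    (a_kappa : indefinite_integral kappa a)
    (uL_plus_bounds : forall i : 'I_N,
       umin <= uL_plus f a dx dt s i <= umax)
    (uL_minus_bounds : forall i : 'I_N,
       umin <= uL_minus f a dx dt s i <= umax)
    (CFL_le : CFL <= 1 / 2)
    (CFL_cond : CFL_condition f kappa umin umax dx dt CFL s) :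
  [/\ forall i : 'I_N, umin <= avg_Lim f a umin umax dx dt s i <= umax,
      locally_conservative f dx dt
        (@convection_Lim R N f a umin umax dx dt)
        (@fLim R N f a umin umax dx dt)
    & doubly_conservative a dx dt
        (@diffusion_Lim R N f a umin umax dx dt)
        (@aLim R N f a umin umax dx dt)].
Proof.
split.
- by move=> i; apply: avg_Lim_bounds => //; rewrite gt_eqF.
(* The difference form holds by definition of [convection_Lim], which leaves consistency; likewise
   for the diffusion. *)
- by split=> // u i; exact: fLim_const.
- by split=> // u i; exact: aLim_const.
Qed.
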